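(* Let $\mathcal{F}$ be a Fréchet–Urysohn filter on $\mathbb{N}$. Then $\mathcal{S}_c(\xi(\mathcal{F}))$ is homeomorphic to the space $\mathbb{P}$ of irrational numbers if and only if $\mathcal{F}$ has a countable (filter) base.
   Context: A free filter on $\mathbb{N}$ is a proper filter $\mathcal{F}$ with $\bigcap\mathcal{F}=\emptyset$. For a free filter $\mathcal{F}$ on $\mathbb{N}$, $\xi(\mathcal{F})$ is the space with underlying set $\mathbb{N}\cup\{\mathcal{F}\}$ in which all elements of $\mathbb{N}$ are isolated and the neighborhoods of the point $\mathcal{F}$ are the sets $A\cup\{\mathcal{F}\}$ with $A\in\mathcal{F}$. A Fréchet–Urysohn filter on $\mathbb{N}$ is a free filter $\mathcal{F}$ such that $\xi(\mathcal{F})$ is Fréchet–Urysohn (whenever $x\in\overline{A}$, some sequence of points of $A$ converges to $x$). $\mathbb{P}$ carries its usual topology as a subspace of $\mathbb{R}$. For a Tychonoff space $X$, a nontrivial convergent sequence of $X$ is a subset $S\subseteq X$ such that $|S|=\omega$, $S$ (as a subspace) has a unique non-isolated point, denoted $x_S$, and $|S\setminus U|<\omega$ for each neighborhood $U$ of $x_S$. Let $\mathcal{CL}(X)$ be the set of all nonempty closed subsets of $X$, with the Vietoris topology: a base consists of the sets $\langle \mathcal{U}\rangle=\{F\in\mathcal{CL}(X): F\subseteq\bigcup\mathcal{U}\text{ and }F\cap U\neq\emptyset\text{ for all }U\in\mathcal{U}\}$, where $\mathcal{U}$ runs over nonempty finite families of nonempty open subsets of $X$. Let $\mathcal{S}_c(X)=\{S\in\mathcal{CL}(X):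 S\text{ is a nontrivial convergent sequence of }X\}$ with the subspace topology. *)

(* Defs.v *)
From HB Require Import structures.
From mathcomp Require Import all_boot all_order all_algebra.
From mathcomp Require Import all_classical all_reals all_analysis.
Import Order.TTheory GRing.Theory Num.Theory numFieldNormedType.Exports.

Set Implicit Arguments.
Unset Strict Implicit.
Unset Printing Implicit Defensive.

Local Open Scope classical_set_scope.
Local Open Scope card_scope.

Definition homeomorphic (X Y : topologicalType) : Prop :=
  exists (f : X -> Y) (g : Y -> X),
    [/\ continuous f, continuous g, cancel f g & cancel g f].

Definition frechet_urysohn (X : topologicalType) : Prop :=
  forall (A : set X) (x : X), closure A x ->
    exists u : nat -> X, (forall n, A (u n)) /\ u @ \oo --> x.

Definition nontrivial_convergent_sequence (X : topologicalType) (S : set X)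
    : Prop :=
  S #= [set: nat] /\
  exists xS : X, S `\` isolated S = [set xS] /\
    forall U, nbhs xS U -> finite_set (S `\` U).

(* [XiNat n] is the isolated point n, [XiPt] is the point denoted by the filter
   itself *)
Variant xi (F : pfilter_on nat) : Type := XiNat of nat | XiPt.
Arguments XiNat {F} n.
Arguments XiPt {F}.

Section xi_topology.
Variable F : pfilter_on nat.

HB.instance Definition _ := gen_eqMixin (xi F).
HB.instance Definition _ := gen_choiceMixin (xi F).

Definition xi_nbhs (x : xi F) : set_system (xi F) :=
  match x with
  | XiNat n => [set B | B (XiNat n)]
  | XiPt => [set XiNat @` A `|` [set XiPt] | A in F]
  end.

Lemma xi_nbhs_PtE (B : set (xi F)) :
  xi_nbhs XiPt B <-> F (XiNat @^-1` B) /\ B XiPt.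
Proof.
split=> [[A FA <-]|[FB BN]].
  split; last by right.
  by apply: filterS FA => n An; left; exists n.
exists (XiNat @^-1` B) => //; apply/seteqP; split=> [x [[n Bn <-//]|->//]|].
by case=> [n Bn|_]; [left; exists n | right].
Qed.

Let xi_nbhs_filter (x : xi F) : ProperFilter (xi_nbhs x).
Proof.
case: x => [n|].
  by split=> //; split=> // A B AB /AB.
split; first by move/xi_nbhs_PtE => [].
split=> [|A B /xi_nbhs_PtE[FA AN] /xi_nbhs_PtE[FB BN]|A B AB /xi_nbhs_PtE[FA AN]].
- by apply/xi_nbhs_PtE; split => //; exact: filterT.
- by apply/xi_nbhs_PtE; split => //; exact: filterI.
- by apply/xi_nbhs_PtE; split; [apply: filterS FA => n /AB|exact: AB].
Qed.

Let xi_nbhs_singleton (x : xi F) (B : set (xi F)) : xi_nbhs x B -> B x.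
Proof. by case: x => [n|/xi_nbhs_PtE[]]. Qed.

Let xi_nbhs_nbhs (x : xi F) (B : set (xi F)) :
  xi_nbhs x B -> xi_nbhs x (xi_nbhs^~ B).
Proof. by case: x => [n //|BN]; apply/xi_nbhs_PtE; case/xi_nbhs_PtE: (BN). Qed.

HB.instance Definition _ := hasNbhs.Build (xi F) xi_nbhs.
HB.instance Definition _ := Nbhs_isNbhsTopological.Build (xi F)
  xi_nbhs_filter xi_nbhs_singleton xi_nbhs_nbhs.

End xi_topology.

Definition frechet_urysohn_filter (F : pfilter_on nat) : Prop :=
  \bigcap_(A in F) A = set0 /\ frechet_urysohn (xi F).

Definition has_countable_base (F : pfilter_on nat) : Prop :=
  exists B : set (set nat), [/\ countable B, B `<=` F &
    forall A, F A -> exists2 C, B C & C `<=` A].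

Record CL (X : topologicalType) : Type := MkCL {
  CL_set :> set X;
  CL_neq0 : CL_set !=set0;
  CL_closed : closed CL_set }.

Section vietoris_topology.
Variable X : topologicalType.

HB.instance Definition _ := gen_eqMixin (CL X).
HB.instance Definition _ := gen_choiceMixin (CL X).

Definition vietoris_family : set (set (set X)) :=
  [set U | [/\ finite_set U, U !=set0 &
              forall B, U B -> open B /\ B !=set0]].

Definition vietoris_base (U : set (set X)) : set (CL X) :=
  [set F : CL X | F `<=` \bigcup_(B in U) B /\
                  forall B, U B -> F `&` B !=set0].

Let vietoris_cover :
  \bigcup_(U in vietoris_family) vietoris_base U = setT.
Proof.
apply/seteqP; split=> // F _; have [x Fx] := CL_neq0 F.
exists [set setT].
  split; [exact: finite_set1|by exists setT|move=> _ ->].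
  by split; [exact: openT|exists x].
split=> [y Fy|_ ->]; first by exists setT.
by exists x.
Qed.

Let vietoris_join (U V : set (set X)) (F : CL X) :
  vietoris_family U -> vietoris_family V ->
  vietoris_base U F -> vietoris_base V F ->
  exists W, [/\ vietoris_family W, vietoris_base W F &
    vietoris_base W `<=` vietoris_base U `&` vietoris_base V].
Proof.
move=> [finU [U0 UU0] oU] [finV [V0 VV0] oV] [FU UF] [FV VF].
set u := \bigcup_(B in U) B; set v := \bigcup_(B in V) B.
have ou : open u by apply: bigcup_open => B /oU[].
have ov : open v by apply: bigcup_open => B /oV[].
exists ((fun B => B `&` v) @` U `|` (fun B => B `&` u) @` V); split.
- split.
  + by rewrite finite_setU; split; exact: finite_image.
  + by exists (U0 `&` v); left; exists U0.
  + move=> _ [[B UO <-]|[B VO <-]].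
    * split; first by apply: openI => //; case: (oU _ UO).
      by have [x [Fx Ox]] := UF _ UO; exists x; split => //; exact: FV.
    * split; first by apply: openI => //; case: (oV _ VO).
      by have [x [Fx Ox]] := VF _ VO; exists x; split => //; exact: FU.
- split=> [x Fx|_ [[B UO <-]|[B VO <-]]].
  + have [B UO Ox] := FU _ Fx.
    by exists (B `&` v); [left; exists B|split => //; exact: FV].
  + by have [x [Fx Ox]] := UF _ UO; exists x; do 2?split => //; exact: FV.
  + by have [x [Fx Ox]] := VF _ VO; exists x; do 2?split => //; exact: FU.
- move=> G -[GW WG]; split; split.
  + by move=> x /GW[_ [[B UO <-] [Ox _]|[B VO <-] [_ //]]]; exists B.
  + move=> B UO; have [|x [Gx [Ox _]]] := WG (B `&` v); last by exists x.
    by left; exists B.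
  + by move=> x /GW[_ [[B UO <-] [_ //]|[B VO <-] [Ox _]]]; exists B.
  + move=> B VO; have [|x [Gx [Ox _]]] := WG (B `&` u); last by exists x.
    by right; exists B.
Qed.

HB.instance Definition _ := isBaseTopological.Build (CL X)
  vietoris_cover vietoris_join.

End vietoris_topology.

(* used through [set_type], which carries the subspace topology *)
Definition Sc (X : topologicalType) : set (CL X) :=
  [set S : CL X | nontrivial_convergent_sequence S].
Arguments Sc X : clear implicits.

(* Main.v *)
Require Import Defs.
From HB Require Import structures.
From mathcomp Require Import all_boot all_order all_algebra.
From mathcomp Require Import all_classical all_reals all_analysis.
From mathcomp Require Import ring lra zify.
Import Order.TTheory GRing.Theory Num.Theory numFieldNormedType.Exports.
Local Open Scope classical_set_scope.

(** Write a nontrivial convergent sequence S of xi(F) as B together with the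
    point F, where B is a subset of nat. Since the natural numbers are
    isolated, S qualifies exactly when B is infinite and B is contained in each
    member of F up to finitely many points ([convergent_sequence_XiPt],
    [trace_surj]), and for a free filter the sets of those T whose trace has
    the same points outside U as the trace of S, for U in F, form a base of
    neighbourhoods of S in the Vietoris topology ([nbhs_trace]).

    If the space of these sequences is homeomorphic to the irrationals, it has
    a point S with a countable neighbourhood base, hence members U_n of F such
    that each U in F is governed by some U_n. Adding to S one point x of U_n
    does not change S outside U_n, so it must not change S outside U: every
    point of U_n that is not in S lies in U. As S is almost contained in U, the
    sets U_n minus finite initial segments form a base of F
    ([countable_base_of_local_base]).

    Conversely, a homeomorphism is obtained by coding both spaces as the Baire
    space, the set of sequences of naturals. A space is so coded as soon as its
    points have sequences of labels for which cylinders are neighbourhood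
    bases, coherent sequences of labels are realised, and every cylinder splits
    into countably infinitely many cylinders ([baire_scheme],
    [baire_scheme_homeomorphic]).

    For the convergent sequences, take a decreasing base U_0 = nat, U_1, ... of
    F. Starting from b_0 = 0, let b_(i+1) be the first v such that B has a
    point in U_(b_i) outside U_v; the i-th label is b_(i+1) with the finite set
    of the points of B outside U_(b_(i+1)) ([label_scheme]). Each step adds a
    nonempty finite set to the part of B already known, and arbitrarily late
    first additions are possible, so the splitting is infinite.

    For the irrationals, let h be an increasing contraction of the line onto
    ]0, 1[ that is piecewise a homography with integer coefficients. Every
    non-integer is uniquely a + h(y) with a an integer, its floor; iterating
    x |-> y gives the digits of x, as the Gauss map does for continued
    fractions. Contraction makes the cylinders small and every sequence of
    integers a sequence of digits; rationals are excluded because the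
    denominator drops at each step until an integer is reached
    ([digits_scheme]). *)

Set Implicit Arguments.
Unset Strict Implicit.
Unset Printing Implicit Defensive.
Local Open Scope card_scope.

(** * Spaces coded by sequences of labels *)

Definition agree (T : Type) (n : nat) (s t : nat -> T) : Prop :=
  forall k, (k < n)%N -> s k = t k.

Lemma agree_sym (T : Type) n (s t : nat -> T) : agree n s t -> agree n t s.
Proof. by move=> st k /st. Qed.

Lemma agree_trans (T : Type) n (s t u : nat -> T) :
  agree n s t -> agree n t u -> agree n s u.
Proof. by move=> st tu k kn; rewrite st ?tu. Qed.

Lemma agree_le (T : Type) m n (s t : nat -> T) :
  (m <= n)%N -> agree n s t -> agree m s t.
Proof. by move=> mn st k km; apply: st; exact: leq_trans mn. Qed.

Lemma agreeS (T : Type) n (s t : nat -> T) :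
  agree n.+1 s t <-> agree n s t /\ s n = t n.
Proof.
split=> [st|[st stn] k]; first by split; [exact: agree_le st|exact: st].
by rewrite ltnS leq_eqVlt => /orP[/eqP->|/st].
Qed.

Definition cylinder (X T : Type) (c : X -> nat -> T) n (x : X) : set X :=
  [set y | agree n (c y) (c x)].

(** The tree of cylinders of [c] is isomorphic to the tree of finite sequences
    of naturals: by [scheme_inj] and [scheme_complete] its branches are exactly
    the points, and by [scheme_split] every node has countably infinitely many
    successors. The labels themselves may come from any type, and those
    available at a node may depend on that node. *)
Record baire_scheme (X : topologicalType) (T : Type) (c : X -> nat -> T)
    : Prop := BaireScheme {
  scheme_inj : injective c;
  scheme_complete : forall t, (forall n, exists x, agree n (c x) t) ->
    exists x, c x = t;
  scheme_nbhs : forall x W, nbhs x W <-> exists n, cylinder c n x `<=` W;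
  scheme_split : forall x n, c^~ n @` cylinder c n x #= [set: nat] }.

(** Numbering the successors of each node by the naturals turns labels into
    coordinates that run freely through all sequences of naturals. *)
Lemma baire_scheme_coordinates (X : topologicalType) (T : Type)
    (c : X -> nat -> T) :
  [set: X] !=set0 -> baire_scheme c ->
  exists d : X -> nat -> nat, [/\ injective d, forall f, exists x, d x = f &
    forall x W, nbhs x W <-> exists n, cylinder d n x `<=` W].
Proof.
move=> [x0 _] [c_inj c_complete c_nbhs c_split].
have /choice[e eP] (A : set T) :
    exists e : T -> nat, A #= [set: nat] -> set_bij A [set: nat] e.
  case: (pselect (A #= [set: nat])) => [AN|nAN]; last by exists (fun=> 0%N).
  by have /card_set_bijP[e eA] := AN; exists e.
(* The numbering of the successors is chosen as a function of the set [L n x] of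
   labels that follow, so points of one cylinder share it. *)
pose L n x := c^~ n @` cylinder c n x.
have LE n x y : agree n (c x) (c y) -> L n x = L n y.
  move=> xy; congr (_ @` _); apply/seteqP; split=> z zx.
    exact: agree_trans xy.
  exact: agree_trans (agree_sym xy).
have cL n x : L n x (c x n) by exists x.
pose d x n := e (L n x) (c x n).
have dcE n x y : agree n (d x) (d y) <-> agree n (c x) (c y).
  split=> [|xy k kn]; last first.
    by rewrite /d (@LE k x y) ?xy//; apply: agree_le xy; exact: ltnW.
  elim: n => [//|n IH] /agreeS[/IH xy dxy]; apply/agreeS; split=> //.
  have [_ inj _] := eP _ (c_split x n).
  apply: inj; rewrite ?inE; [exact: cL|by rewrite -/(L n x) (LE _ _ _ xy)|].
  by rewrite [RHS](_ : _ = d y n)// /d -(LE _ _ _ xy).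
exists d; split.
- move=> x y dxy; apply: c_inj; apply/funext => n.
  by have /dcE/(_ n (ltnSn n)) : agree n.+1 (d x) (d y) by rewrite dxy.
- move=> f.
  have /choice[x xf] n : exists x, agree n (d x) f.
    elim: n => [|n [x xf]]; first by exists x0.
    have [_ _ /(_ (f n) I)[_ [y yx <-] eyf]] := eP _ (c_split x n).
    exists y; apply/agreeS; split; last by rewrite /d (LE _ _ _ yx).
    by apply: agree_trans xf; exact/dcE.
  have xx m n : (m <= n)%N -> agree m (c (x m)) (c (x n)).
    move=> mn; apply/dcE/(agree_trans (xf m))/agree_sym.
    exact: agree_le (xf n).
  have [n|y yx] := c_complete (fun k => c (x k.+1) k).
    by exists (x n) => k kn; rewrite (xx k.+1 n).
  exists y; apply/funext => n.
  rewrite -(xf n.+1 n (ltnSn n)).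
  have /dcE -> // : agree n.+1 (c y) (c (x n.+1)).
  by move=> k kn; rewrite yx (xx k.+1 n.+1).
- move=> x W; rewrite c_nbhs.
  by split=> -[n nW]; exists n => y /dcE; exact: nW.
Qed.

Lemma baire_scheme_homeomorphic (X Y : topologicalType) (T U : Type)
    (c : X -> nat -> T) (d : Y -> nat -> U) :
  [set: X] !=set0 -> [set: Y] !=set0 -> baire_scheme c -> baire_scheme d ->
  homeomorphic X Y.
Proof.
move=> X0 Y0 /(baire_scheme_coordinates X0)[{}c [c_inj c_surj c_nbhs]].
move=> /(baire_scheme_coordinates Y0)[{}d [d_inj d_surj d_nbhs]].
have /choice[f fE] x : exists y, d y = c x by exact: d_surj.
have /choice[g gE] y : exists x, c x = d y by exact: c_surj.
exists f, g; split.
- move=> x W /d_nbhs[n nW]; apply/c_nbhs; exists n => x' xx'.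
  by apply: nW; rewrite /cylinder/= !fE.
- move=> y W /c_nbhs[n nW]; apply/d_nbhs; exists n => y' yy'.
  by apply: nW; rewrite /cylinder/= !gE.
- by move=> x; apply: c_inj; rewrite gE fE.
- by move=> y; apply: d_inj; rewrite fE gE.
Qed.

(** * Convergent sequences as subsets of nat *)

Section Trace.
Variable F : pfilter_on nat.
Local Notation X := (xi F).
Local Notation Scxi := (set_type (Sc X)).

Lemma nbhs_XiPt (B : set X) : nbhs XiPt B <-> F (XiNat @^-1` B) /\ B XiPt.
Proof. exact: xi_nbhs_PtE. Qed.

Lemma nbhs_XiNat n (B : set X) : nbhs (XiNat n) B = B (XiNat n).
Proof. by []. Qed.

Lemma open_xi (B : set X) : open B <-> (B XiPt -> F (XiNat @^-1` B)).
Proof.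
rewrite openE; split=> [/(_ XiPt) oB BPt|FB [n Bn|BPt]].
- by have /nbhs_XiPt[] := oB BPt.
- by rewrite /interior nbhs_XiNat.
- by apply/nbhs_XiPt; split=> //; exact: FB.
Qed.

Lemma countable_xi : countable [set: X].
Proof.
apply/countable_injP.
exists (fun x => if x is XiNat n then n.+1 else 0%N).
by move=> [m|] [n|] _ _ // [->].
Qed.

Lemma finite_XiNat_preimage (A : set X) :
  finite_set A -> finite_set (XiNat @^-1` A).
Proof. by move=> finA; apply: finite_preimage => // m n _ _ []. Qed.

Definition trace (S : Scxi) : set nat := XiNat @^-1` CL_set (set_val S).

Definition pseudointersection (B : set nat) : Prop :=
  infinite_set B /\ forall U, F U -> finite_set (B `\` U).

Lemma convergent_sequence_XiPt (S : set X) :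
  nontrivial_convergent_sequence S ->
  S XiPt /\ pseudointersection (XiNat @^-1` S).
Proof.
move=> [SN [x [Sx finS]]].
have Sinf : infinite_set S.
  by apply/infiniteP; rewrite card_eqPle in SN; case: SN.
have [Sxx nix] : (S `\` isolated S) x by rewrite Sx.
(* A natural number is isolated in S, so the non-isolated point is [XiPt]. *)
case: x Sx finS Sxx nix => [n|] Sx finS Sxx nix.
  exfalso; apply: nix; split; first exact/mem_set.
  exists [set XiNat n]; first by rewrite nbhs_XiNat.
  by apply/seteqP; split=> y; [case|move=> ->; split].
split=> //; split=> [fin|U FU]; last first.
  apply: (@sub_finite_set _ _
    (XiNat @^-1` (S `\` (XiNat @` U `|` [set XiPt])))).
    by move=> n [Sn nU]; split=> // -[[m Um [mn]]|//]; apply: nU; rewrite -mn.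
  by apply/finite_XiNat_preimage/finS; exists U.
apply: Sinf.
apply: (@sub_finite_set _ _ (XiNat @` (XiNat @^-1` S) `|` [set XiPt])).
  by move=> [n|] Sn; [left; exists n|right].
by rewrite finite_setU; split=> //; exact: finite_image.
Qed.

Lemma trace_XiPt (S : Scxi) : CL_set (set_val S) XiPt.
Proof. by have [] := convergent_sequence_XiPt (set_mem (valP S)). Qed.

Lemma trace_infinite (S : Scxi) : infinite_set (trace S).
Proof. by have [_ []] := convergent_sequence_XiPt (set_mem (valP S)). Qed.

Lemma trace_finite (S : Scxi) U : F U -> finite_set (trace S `\` U).
Proof.
by have [_ [_]] := convergent_sequence_XiPt (set_mem (valP S)); exact.
Qed.

Lemma trace_inj : injective trace.
Proof.
move=> S T ST; apply: val_inj.
suff : CL_set (val S) = CL_set (val T).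
  move: (val S) (val T) => [A A0 cA] [B B0 cB] /= AB.
  by subst B; congr MkCL; exact: Prop_irrelevance.
apply/funext => -[n|]; first exact: (congr1 (@^~ n) ST).
by apply/propext; split=> _; exact: trace_XiPt.
Qed.

Lemma trace_surj (B : set nat) :
  pseudointersection B -> exists S : Scxi, trace S = B.
Proof.
move=> [Binf Bfin].
pose S : set X := XiNat @` B `|` [set XiPt].
have SB : XiNat @^-1` S = B.
  by apply/seteqP; split=> [n [[m Bm [<-//]]|//]|n Bn]; left; exists n.
have S0 : S !=set0 by exists XiPt; right.
have cS : closed S.
  by rewrite -openC; apply/open_xi => nS; exfalso; apply: nS; right.
have Sinf : infinite_set S.
  by move=> /finite_XiNat_preimage; rewrite SB.
have Sseq : nontrivial_convergent_sequence S.
  split.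
    rewrite card_eqPle; split; last exact/infiniteP.
    by apply: sub_countable countable_xi; exact: subset_card_le.
  exists XiPt; split.
    apply/seteqP; split=> [[n|//] [Sn nin]|_ ->].
      exfalso; apply: nin; split; first exact/mem_set.
      exists [set XiNat n]; first by rewrite nbhs_XiNat.
      by apply/seteqP; split=> y; [case|move=> ->; split].
    split; first by right.
    move=> [_ [V /nbhs_XiPt[FV _] VS]]; apply: Binf.
    apply: sub_finite_set (Bfin _ FV) => n Bn; split=> // Vn.
    have : (V `&` S) (XiNat n) by split=> //; left; exists n.
    by rewrite VS.
  move=> U /nbhs_XiPt[FU UPt].
  apply: sub_finite_set (finite_image XiNat (Bfin _ FU)).
  by move=> [n|] [[[m Bm mn]|//] nU]; exists m => //; split=> //; rewrite /= mn.
by exists (exist _ (MkCL S0 cS) (mem_set Sseq)).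
Qed.

Hypothesis free : \bigcap_(A in F) A = set0.

(** Freeness of the filter is used in this form: finite sets may be removed from
    its members. *)
Lemma free_filter_cofinite (K : set nat) : finite_set K -> F (~` K).
Proof.
move=> finK.
have notin n : F (~` [set n]).
  have : ~ (\bigcap_(A in F) A) n by rewrite free.
  move=> /existsNP[A /not_implyP[FA nA]].
  by apply: filterS FA => m Am mn; apply: nA; rewrite -mn.
have -> : ~` K = \bigcap_(n in K) ~` [set n].
  by rewrite -setC_bigcup bigcup_imset1 image_id.
by have [D ->] := finite_fsetP.1 finK; apply: filter_bigI => n _; exact: notin.
Qed.

Lemma vietoris_nbhs (S : Scxi) (W : set Scxi) :
  nbhs S W <-> exists U : set (set X),
    [/\ vietoris_family U, vietoris_base U (set_val S) &
        forall T : Scxi, vietoris_base U (set_val T) -> W T].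
Proof.
split=> [|[U [FU US UW]]].
  rewrite nbhsE => -[_ [[V [D DF <-] <-] [U DU US]] VW].
  exists U; split=> //; first exact: DF.
  by move=> T UT; apply: VW; exists U.
rewrite nbhsE; exists (set_val @^-1` vietoris_base U) => //; split=> //.
exists (vietoris_base U) => //; exists [set U]; first by move=> _ ->.
by rewrite bigcup_set1.
Qed.

(** A Vietoris neighbourhood requires a sequence to stay in an open set
    containing S and to meet finitely many open sets. Each of the latter
    contains a natural number of S; removing these numbers from U forces every T
    that agrees with S outside U to contain them. In the other direction,
    agreement outside U is itself a Vietoris condition because S has only
    finitely many points there. *)
Lemma nbhs_trace (S : Scxi) (W : set Scxi) :
  nbhs S W <-> exists2 U, F U &
    forall T : Scxi, trace T `\` U = trace S `\` U -> W T.
Proof.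
rewrite vietoris_nbhs; split=> [[V [[finV V0 oV] [SV VS] VW]]|[U FU UW]].
  (* If an open set of [V] meets S only at [XiPt] a priori, it is in fact a
     neighbourhood of [XiPt] and contains almost all points of S. *)
  have /choice[k kP] B : exists k, V B -> trace S k /\ B (XiNat k).
    have [VB|nVB] := pselect (V B); last by exists 0%N.
    have [[k|] [Sx Bx]] := VS _ VB; first by exists k.
    have FB : F (XiNat @^-1` B) by have /open_xi := (oV _ VB).1; apply.
    have /infinite_setN0[n [Sn nSB]] :=
      infinite_setD (@trace_infinite S) (trace_finite S FB).
    by exists n; split=> //; apply: contrapT => nB; exact: nSB.
  pose U := (XiNat @^-1` \bigcup_(B in V) B) `&` ~` (k @` V).
  exists U.
    apply: filterI; last by apply/free_filter_cofinite/finite_image.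
    have /open_xi : open (\bigcup_(B in V) B).
      by apply: bigcup_open => B /oV[].
    by apply; apply: SV; exact: trace_XiPt.
  move=> T TS; apply: VW; split.
    move=> [n Tn|_]; last by apply: SV; exact: trace_XiPt.
    have [//|nV] := pselect ((\bigcup_(B in V) B) (XiNat n)).
    apply: SV; have : (trace S `\` U) n.
      by rewrite -TS; split=> // -[].
    by case.
  move=> B VB; have [Sk Bk] := kP _ VB.
  exists (XiNat (k B)); split=> //.
  have : (trace S `\` U) (k B).
    by split=> // -[_]; apply; exists B.
  by rewrite -TS => -[].
pose N := XiNat @` U `|` [set XiPt] : set X.
have NU : XiNat @^-1` N = U.
  by apply/seteqP; split=> [n [[m Um [<-//]]|//]|n Un]; left; exists n.
exists ([set N] `|` (fun n => [set XiNat n]) @` (trace S `\` U)); split.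
- split.
  + by rewrite finite_setU; split=> //; apply/finite_image/trace_finite.
  + by exists N; left.
  + move=> B [->|[n [Sn nU] <-]].
      split; last by exists XiPt; right.
      by apply/open_xi; rewrite NU.
    by split; [apply/open_xi|exists (XiNat n)].
- split=> [[n Sn|_]|B [->|[n [Sn nU] <-]]].
  + have [Un|nU] := pselect (U n); first by exists N; left => //; exists n.
    by exists [set XiNat n] => //; right; exists n.
  + by exists N; [left|right].
  + by exists XiPt; split; [exact: trace_XiPt|right].
  + by exists (XiNat n).
- move=> T [TV VT]; apply: UW; apply/seteqP; split=> n [Tn nU].
    have [B [->|[m [Sm nUm] <-]]] := TV _ Tn; last by case=> ->.
    by move=> Nn; exfalso; apply: nU; rewrite -NU.
  have [|x [Tx xn]] := VT [set XiNat n]; first by right; exists n.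
  by rewrite xn in Tx.
Qed.
End Trace.

(** * First countability at one point gives a countable base *)

Section CountableBase.
Variable F : pfilter_on nat.
Hypothesis free : \bigcap_(A in F) A = set0.
Local Notation Scxi := (set_type (Sc (xi F))).

(** Let U in F be such that [W n] contains every sequence that agrees with S
    outside U. Adding a point x of U to S gives such a sequence. If [W n] only
    contains sequences that agree with S outside some A in F, then x was in A or
    in S. *)
Lemma countable_base_of_local_base (S : Scxi) (W : nat -> set Scxi) :
  (forall n, nbhs S (W n)) ->
  (forall V, nbhs S V -> exists n, W n `<=` V) ->
  has_countable_base F.
Proof.
move=> SW Wbase.
have /choice[U UP] n : exists U, F U /\
    forall T : Scxi, trace T `\` U = trace S `\` U -> W n T.
  by have /(nbhs_trace free)[U FU UW] := SW n; exists U.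
exists (range (fun p : nat * nat => U p.1 `&` ~` `I_p.2)); split.
- exact: (sub_countable (card_image_le _ _)).
- move=> _ [p _ <-]; apply: filterI; first by have [] := UP p.1.
  exact/free_filter_cofinite/finite_II.
- move=> A FA.
  pose V : set Scxi := [set T | trace T `\` A = trace S `\` A].
  have [|n WV] := Wbase V; first by apply/(nbhs_trace free); exists A.
  have UA : U n `\` trace S `<=` A.
    move=> x [Ux nSx]; have [FU UW] := UP n.
    have [|T TE] := @trace_surj F (trace S `|` [set x]).
      split; first by apply: sub_infinite_set (@trace_infinite _ S) => y; left.
      move=> B FB; rewrite setDUl finite_setU; split; first exact: trace_finite.
      exact: finite_setD.
    have /WV : W n T.
      apply: UW; rewrite TE; apply/seteqP; split=> y.
        by case=> -[Sy|->] nUy //; split.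
      by case=> Sy nUy; split=> //; left.
    rewrite /V/= TE => TS; apply: contrapT => nAx.
    have : ((trace S `|` [set x]) `\` A) x by split=> //; right.
    by rewrite TS => -[].
  have [k kP] : exists k, trace S `\` A `<=` `I_k.
    have /finite_seqP[s ->] := trace_finite S FA.
    exists (\max_(i <- s) i).+1 => i si.
    by rewrite /= ltnS; exact: leq_bigmax_seq.
  exists (U n `&` ~` `I_k); first by exists (n, k).
  move=> x [Ux nkx]; have [Sx|nSx] := pselect (trace S x); last exact: UA.
  by apply: contrapT => nAx; apply: nkx; exact: kP.
Qed.

(** * Labels for the convergent sequences *)

Lemma decreasing_base : has_countable_base F ->
  exists U : nat -> set nat, [/\ U 0%N = setT,
    forall m n, (m <= n)%N -> U n `<=` U m, forall n, F (U n) &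
    forall A, F A -> exists n, U n `<=` A].
Proof.
move=> [B [Bcount BF Bbase]].
have [C BC _] := Bbase _ filterT.
have [e eP] : exists e : nat -> set nat, B = range e.
  have /pfcard_geP[B0|[e]] := Bcount; first by rewrite B0 in BC.
  exists e; apply/seteqP; split=> [A /(@surj _ _ _ _ e)[n _ <-]|_ [n _ <-]].
    by exists n.
  exact: funS.
exists (fun n => \bigcap_(i in `I_n) e i); split.
- by rewrite II0 bigcap_set0.
- by move=> m n mn x Ux i im; apply: Ux; exact: leq_trans mn.
- move=> n; have /finite_fsetP[D ->] := finite_II n.
  by apply: filter_bigI => i _; apply: BF; rewrite eP; exists i.
- move=> A /Bbase[D]; rewrite eP => -[n _ <-] eA; exists n.+1 => x Ux.
  by apply: eA; apply: Ux => /=.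
Qed.

Section Scheme.
Variable U : nat -> set nat.
Hypothesis U0 : U 0%N = setT.
Hypothesis U_decr : forall m n, (m <= n)%N -> U n `<=` U m.
Hypothesis FU : forall n, F (U n).
Hypothesis U_base : forall A, F A -> exists n, U n `<=` A.

Definition outside (S : Scxi) k : set nat := trace S `\` U k.

Definition point_between (S : Scxi) k v : Prop :=
  exists x, [/\ trace S x, U k x & ~ U v x].

Lemma finite_outside S k : finite_set (outside S k).
Proof. exact: trace_finite. Qed.

Lemma U_avoid (K : set nat) : finite_set K -> exists n, K `&` U n = set0.
Proof.
move=> /(free_filter_cofinite free)/U_base[n UK]; exists n.
by apply/seteqP; split=> // x [Kx /UK].
Qed.

Lemma infinite_meets_U (B : set nat) k :
  infinite_set B -> finite_set (B `\` U k) -> exists x, B x /\ U k x.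
Proof.
move=> Binf fin; have /infinite_setN0[x [Bx nx]] := infinite_setD Binf fin.
by exists x; split=> //; apply: contrapT => nUx; apply: nx.
Qed.

Lemma point_between_ex S k : exists v, `[< point_between S k v >].
Proof.
have [x [Sx Ux]] := infinite_meets_U (@trace_infinite _ S) (finite_outside S k).
have [v xv] := U_avoid (finite_set1 x).
exists v; apply/asboolP; exists x; split=> // Uvx.
suff : ([set x] `&` U v) x by rewrite xv.
by [].
Qed.

(** Layers of the base without points of [S] are skipped, so each cut reveals a
    new point. *)
Definition next_cut S k : nat := ex_minn (point_between_ex S k).

Lemma next_cutP S k : point_between S k (next_cut S k) /\
  forall v, point_between S k v -> (next_cut S k <= v)%N.
Proof.
rewrite /next_cut; case: ex_minnP => v /asboolP vl vmin; split=> // w wl.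
by apply: vmin; apply/asboolP.
Qed.

Lemma next_cut_gt S k : (k < next_cut S k)%N.
Proof.
have [[x [_ Ukx nUx]] _] := next_cutP S k.
rewrite ltnNge; apply/negP => /U_decr.
by move=> /(_ _ Ukx).
Qed.

Lemma outside_le S T u v : (u <= v)%N ->
  outside T v = outside S v -> outside T u = outside S u.
Proof.
move=> uv TS.
have nU x : ~ U u x -> ~ U v x by apply: contra_not; exact: U_decr.
apply/seteqP; split=> x [Bx nx].
  by have : outside T v x by [split=> //; exact: nU]; rewrite TS => -[].
by have : outside S v x by [split=> //; exact: nU]; rewrite -TS => -[].
Qed.

Lemma point_between_outside S T k v : outside T v = outside S v ->
  point_between S k v -> point_between T k v.
Proof.
move=> TS [x [Sx Ux nUx]]; exists x; split=> //.
by have : outside S v x by []; rewrite -TS => -[].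
Qed.

(** The next cut is found by inspecting only the points outside [U v], for any
    [v] that it does not exceed. *)
Lemma next_cut_outside S T k v :
  (next_cut S k <= v)%N -> outside T v = outside S v ->
  next_cut T k = next_cut S k.
Proof.
move=> Sv TS; have [Sl Smin] := next_cutP S k; have [Tl Tmin] := next_cutP T k.
have TleS : (next_cut T k <= next_cut S k)%N.
  exact/Tmin/(point_between_outside _ Sl)/(outside_le Sv TS).
apply/eqP; rewrite eqn_leq TleS/=; apply/Smin/(point_between_outside _ Tl).
by apply/esym/(outside_le _ TS)/(leq_trans TleS).
Qed.

Fixpoint cut S i : nat := if i is j.+1 then next_cut S (cut S j) else 0.

Lemma cut_homo S : {homo cut S : i j / (i <= j)%N}.
Proof.
apply: homo_leq => [//|j i k|i]; first exact: leq_trans.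
exact/ltnW/next_cut_gt.
Qed.

Lemma cut_ge S i : (i <= cut S i)%N.
Proof. by elim: i => // i IH; apply: leq_ltn_trans IH (next_cut_gt _ _). Qed.

(** The cut is recorded along with the points so that equal labels have equal
    cuts by definition. *)
Definition label S i : nat * set nat := (cut S i.+1, outside S (cut S i.+1)).

Lemma label_agree_cut S T i : agree i (label T) (label S) -> cut T i = cut S i.
Proof. by case: i => // i /(_ i (ltnSn i))[]. Qed.

(** Cylinders are thus sets of sequences that agree outside a member of the
    base, as basic neighbourhoods are. *)
Lemma label_agree S T i :
  agree i (label T) (label S) <-> outside T (cut S i) = outside S (cut S i).
Proof.
split=> [|TS k ki].
  case: i => [_|i /(_ i (ltnSn i))[-> //]].
  by rewrite /outside /= U0 !setDT.
have cutTS j : (j <= i)%N -> cut T j = cut S j.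
  elim: j => //= j IH ji; rewrite IH; last exact: ltnW.
  by apply: next_cut_outside TS; exact: (cut_homo S ji).
rewrite /label cutTS//; congr pair.
by apply: outside_le TS; exact: cut_homo.
Qed.

Lemma nbhs_outside (S : Scxi) (W : set Scxi) :
  nbhs S W <-> exists n, forall T, outside T n = outside S n -> W T.
Proof.
rewrite (nbhs_trace free); split=> [[A FA AW]|[n nW]]; last by exists (U n).
have [n UA] := U_base FA; exists n => T TS; apply: AW.
have nU x : ~ A x -> ~ U n x by apply: contra_not; exact: UA.
apply/seteqP; split=> x [Bx nx].
  by have : outside T n x by [split=> //; exact: nU]; rewrite TS => -[].
by have : outside S n x by [split=> //; exact: nU]; rewrite -TS => -[].
Qed.

Lemma label_inj : injective label.
Proof.
move=> S T ST; apply: trace_inj.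
have hST i : outside T (cut S i) = outside S (cut S i).
  by apply/label_agree; rewrite ST.
apply/seteqP; split=> x Bx; have [n xn] := U_avoid (finite_set1 x);
  have nUx : ~ U (cut S n) x.
- move=> /(U_decr (cut_ge S n)) Ux.
  by suff : ([set x] `&` U n) x by [rewrite xn]; split.
- by have : outside S (cut S n) x by []; rewrite -hST => -[].
- move=> /(U_decr (cut_ge S n)) Ux.
  by suff : ([set x] `&` U n) x by [rewrite xn]; split.
- by have : outside T (cut S n) x by []; rewrite hST => -[].
Qed.

Lemma label_complete (t : nat -> nat * set nat) :
  (forall n, exists S, agree n (label S) t) -> exists S, label S = t.
Proof.
move=> /choice[S St].
have SS m n : (m <= n)%N -> agree m (label (S n)) (label (S m)).
  move=> mn; apply: agree_trans (agree_sym (St m)); exact: agree_le (St n).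
pose b n := cut (S n) n.
have bE m n : (m <= n)%N -> cut (S n) m = b m by move=> /SS/label_agree_cut.
have b_homo m n : (m <= n)%N -> (b m <= b n)%N.
  by move=> mn; rewrite -(bE m n)//; exact: cut_homo.
have outsideE m n : (m <= n)%N -> outside (S n) (b m) = outside (S m) (b m).
  by move=> /SS/label_agree.
(* The finite parts [outside (S n) (b n)] are coherent and determine the
   sequence. *)
pose B : set nat := \bigcup_n outside (S n) (b n).
have Bb n : B `\` U (b n) = outside (S n) (b n).
  apply/seteqP; split=> [x [[m _ [Smx nUx] nUbx]]|x [Sx nUx]]; last first.
    by split=> //; exists n.
  have [mn|/ltnW nm] := leqP m n.
    by have : outside (S m) (b m) x by []; rewrite -(outsideE m n)// => -[].
  by rewrite -(outsideE n m).
have [|T TB] := @trace_surj F B.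
  split=> [finB|A FA].
    have [n Bn] := U_avoid finB.
    have [[x [Sx Ux nUx]] _] := next_cutP (S n.+1) (cut (S n.+1) n).
    suff : (B `&` U n) x by rewrite Bn.
    split; first by exists n.+1.
    exact: U_decr (cut_ge _ _) _ Ux.
  have [n UA] := U_base FA.
  apply: sub_finite_set (finite_outside (S n) (b n)) => x [Bx nAx].
  rewrite -Bb; split=> // Ux; apply/nAx/UA.
  exact: U_decr (cut_ge _ _) _ Ux.
exists T; apply/funext => n; rewrite -(St n.+1 n (ltnSn n)).
suff /label_agree :
    outside T (cut (S n.+1) n.+1) = outside (S n.+1) (cut (S n.+1) n.+1).
  by apply.
by rewrite [LHS]/outside TB; exact: (Bb n.+1).
Qed.

(** If only finitely many labels could follow, the finite sets in them would all
    avoid some [U m]; but deleting from S the points between its [n]-th cut and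
    [U m] gives a sequence of the same cylinder whose next label contains a
    point of [U m]. *)
Lemma label_split S n : label^~ n @` cylinder label n S #= [set: nat].
Proof.
rewrite card_eqPle; split.
  apply: (@sub_countable _ _ _
    ([set: nat] `*` [set A | A `<=` [set: nat] /\ finite_set A])).
    apply: subset_card_le => _ [T _ <-]; split=> //; split=> //.
    exact: finite_outside.
  by apply: countableX => //; exact: countable_finite_subset.
apply/infiniteP => fin.
pose K := \bigcup_(p in label^~ n @` cylinder label n S) p.2.
have [m mP] : exists m, K `&` U m = set0.
  apply: U_avoid; apply: bigcup_finite fin _ => _ [T _ <-].
  exact: finite_outside.
pose w := maxn m (cut S n).
have [|T TB] := @trace_surj F (trace S `&` (~` U (cut S n) `|` U w)).
  split.
    move: (infinite_setD (@trace_infinite _ S) (finite_outside S w)).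
    apply: sub_infinite_set => x [Sx nx]; split=> //; right.
    by apply: contrapT => nUx; apply: nx.
  move=> A FA; apply: sub_finite_set (trace_finite S FA).
  by move=> x [[]].
have ST : agree n (label T) (label S).
  apply/label_agree; rewrite /outside TB; apply/seteqP; split=> x.
    by case=> -[Sx _] nUx; split.
  by case=> Sx nUx; split=> //; split=> //; left.
have [[x [Tx Ux nUx]] _] := next_cutP T (cut T n).
suff : (K `&` U m) x by rewrite mP.
split; first by exists (label T n) => //; exists T.
move: Tx; rewrite TB => -[_ [|Uwx]].
  by rewrite -(label_agree_cut ST).
by apply: U_decr Uwx; exact: leq_maxl.
Qed.

Lemma label_scheme : baire_scheme label.
Proof.
split; [exact: label_inj|exact: label_complete| |exact: label_split].
move=> S W; rewrite nbhs_outside; split=> [[n nW]|[n nW]].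
  exists n => T /label_agree ST; apply: nW; exact: outside_le (cut_ge S n) ST.
by exists (cut S n) => T ST; apply: nW; apply/label_agree.
Qed.

Lemma Sc_nonempty : [set: Scxi] !=set0.
Proof.
have /choice[x xU] n : exists x, U n x.
  exact: filter_ex (FU n).
have [|S _] := @trace_surj F (range x); last by exists S.
split=> [fin|A FA].
  have [n xn] := U_avoid fin.
  by suff : (range x `&` U n) (x n) by [rewrite xn]; split.
have [n UA] := U_base FA.
apply: (@sub_finite_set _ _ (x @` `I_n)); last exact/finite_image/finite_II.
move=> _ [[m _ <-] nAx]; exists m => //=; rewrite ltnNge; apply/negP => nm.
by apply/nAx/UA/(U_decr nm).
Qed.
End Scheme.
End CountableBase.

(** * Digits of irrational numbers *)

Local Open Scope ring_scope.
Section Irrational.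
Variable R : realType.
Implicit Types (x y z t : R) (n : nat) (a : int).

(** This is (1 + y) / (2 + y) for nonnegative y and 1 / (2 - y) otherwise: on
    each side a homography with integer coefficients, so that rationality is
    preserved both ways. *)
Definition to01 y : R := (1 + y / (2 + `|y|)) / 2.

(** The inverse of [to01] on ]0, 1[. *)
Definition of01 t : R := 2 * (2 * t - 1) / (1 - `|2 * t - 1|).

Definition gauss_map x : R := of01 (x - (Num.floor x)%:~R).

Definition digits x n : int := Num.floor (iter n gauss_map x).

Lemma to01_ge0E y : 0 <= y -> to01 y = (1 + y) / (2 + y).
Proof.
move=> y0; rewrite /to01 ger0_norm//; field.
by do ?[apply/andP; split]; lra.
Qed.

Lemma to01_le0E y : y <= 0 -> to01 y = (2 - y)^-1.
Proof.
move=> y0; rewrite /to01 ler0_norm//; field.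
by do ?[apply/andP; split]; lra.
Qed.

Lemma of01_leE t : 0 < t -> t <= 1 / 2 -> of01 t = (2 * t - 1) / t.
Proof.
move=> t0 t1; rewrite /of01 ler0_norm; last by lra.
by field; do ?[apply/andP; split]; lra.
Qed.

Lemma of01_geE t : t < 1 -> 1 / 2 <= t -> of01 t = (2 * t - 1) / (1 - t).
Proof.
move=> t0 t1; rewrite /of01 ger0_norm; last by lra.
by field; do ?[apply/andP; split]; lra.
Qed.

Lemma to01_itv y : 0 < to01 y < 1.
Proof.
have [y0|/ltW y0] := leP 0 y.
  by rewrite to01_ge0E// divr_gt0 ?ltr_pdivrMr; lra.
by rewrite to01_le0E// invr_gt0 invf_lt1; lra.
Qed.

Lemma to01K : cancel to01 of01.
Proof.
move=> y; have [y0|/ltW y0] := leP 0 y.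
  rewrite to01_ge0E// of01_geE; [|by rewrite ltr_pdivrMr; lra|].
    by field; do ?[apply/andP; split]; lra.
  by rewrite ler_pdivlMr; lra.
rewrite to01_le0E// of01_leE; [by field; lra|by rewrite invr_gt0; lra|].
by rewrite div1r lef_pV2 ?posrE; lra.
Qed.

Lemma of01K t : 0 < t < 1 -> to01 (of01 t) = t.
Proof.
move=> /andP[t0 t1]; have [th|/ltW th] := leP t (1 / 2).
  rewrite of01_leE// to01_le0E; last first.
    by rewrite pmulr_lle0 ?invr_gt0//; lra.
  by field; do ?[apply/andP; split]; lra.
rewrite of01_geE// to01_ge0E; last by apply: divr_ge0; lra.
by field; do ?[apply/andP; split]; lra.
Qed.

Lemma to01_contraction y z : y <= z ->
  0 <= to01 z - to01 y <= (z - y) / 2.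
Proof.
move=> yz; have [y0|/ltW y0] := leP 0 y.
- have z0 : 0 <= z by lra.
  have -> : to01 z - to01 y = (z - y) / ((2 + y) * (2 + z)).
    by rewrite !to01_ge0E//; field; do ?[apply/andP; split]; lra.
  have h1 : 0 <= (z - y) * (y * z) by rewrite !mulr_ge0; lra.
  have d0 : 0 < (2 + y) * (2 + z) by nra.
  by rewrite ler_pdivrMr// divr_ge0 ?(ltW d0)//=; nra.
- have [z0|/ltW z0] := leP 0 z.
    have -> : to01 z - to01 y = (z - y - y * z) / ((2 - y) * (2 + z)).
      rewrite (to01_le0E y0) (to01_ge0E z0); field.
      by do ?[apply/andP; split]; lra.
    have h1 : 0 <= (z - y) * (- y * z) by rewrite !mulr_ge0; lra.
    have d0 : 0 < (2 - y) * (2 + z) by nra.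
    by rewrite ler_pdivrMr// divr_ge0 ?(ltW d0)//=; nra.
  have -> : to01 z - to01 y = (z - y) / ((2 - y) * (2 - z)).
    by rewrite !to01_le0E//; field; do ?[apply/andP; split]; lra.
  have h1 : 0 <= (z - y) * (- y * - z) by rewrite !mulr_ge0; lra.
  have d0 : 0 < (2 - y) * (2 - z) by nra.
  by rewrite ler_pdivrMr// divr_ge0 ?(ltW d0)//=; nra.
Qed.

Lemma to01_lipschitz y z : `|to01 z - to01 y| <= `|z - y| / 2.
Proof.
wlog yz : y z / y <= z.
  move=> h; have [/h//|/ltW/h] := leP y z.
  by rewrite distrC (distrC z y).
have /andP[h1 h2] := to01_contraction yz.
by rewrite !ger0_norm// subr_ge0.
Qed.

Lemma to01_continuous : continuous to01.
Proof.
move=> y; apply: cvgM; last exact: cvg_cst.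
apply: cvgD; first exact: cvg_cst.
apply: cvgM; first exact: cvg_id.
apply: cvgV; first by have := normr_ge0 y; lra.
apply: cvgD; first exact: cvg_cst.
exact: cvg_norm.
Qed.

Lemma of01_continuous t : 0 < t < 1 -> {for t, continuous of01}.
Proof.
move=> /andP[t0 t1].
have cu : 2 * x - 1 @[x --> t] --> 2 * t - 1.
  apply: cvgB; last exact: cvg_cst.
  by apply: cvgM; [exact: cvg_cst|exact: cvg_id].
apply: cvgM; first by apply: cvgM => //; exact: cvg_cst.
apply: cvgV; last by apply: cvgB; [exact: cvg_cst|exact: cvg_norm].
by rewrite subr_eq0 eq_sym lt_eqF// ltr_norml; apply/andP; split; lra.
Qed.

Lemma frac_itv x : x != (Num.floor x)%:~R -> 0 < x - (Num.floor x)%:~R < 1.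
Proof.
move=> xf; have /andP[h1 h2] := floor_itv x.
rewrite subr_gt0 lt_neqAle eq_sym xf h1/=.
by rewrite intrD/= in h2; lra.
Qed.

Lemma floor_add_to01 a y : Num.floor (a%:~R + to01 y) = a.
Proof.
have := to01_itv y; move=> /andP[h1 h2]; apply: floor_def.
by rewrite intrD/=; apply/andP; split; lra.
Qed.

Lemma add_to01_nint a y :
  a%:~R + to01 y != (Num.floor (a%:~R + to01 y))%:~R.
Proof.
rewrite floor_add_to01; have /andP[h _] := to01_itv y.
by apply/eqP => h'; lra.
Qed.

Lemma gauss_map_add_to01 a y : gauss_map (a%:~R + to01 y) = y.
Proof. by rewrite /gauss_map floor_add_to01 addrAC subrr add0r to01K. Qed.

Lemma floor_gauss_mapE x : x != (Num.floor x)%:~R ->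
  x = (Num.floor x)%:~R + to01 (gauss_map x).
Proof. by move=> xf; rewrite of01K ?frac_itv// addrC subrK. Qed.

Lemma irrational_nint x : irrational x -> x != (Num.floor x)%:~R.
Proof.
move=> irr; apply/eqP => xE; apply: irr.
by exists (Num.floor x)%:~R; rewrite ?ratr_int.
Qed.

Lemma irrational_gauss_map x : irrational x -> irrational (gauss_map x).
Proof.
move=> irr [q _ qE]; apply: (irr).
rewrite [x]floor_gauss_mapE; last exact: irrational_nint.
exists ((Num.floor x)%:~R + (1 + q / (2 + `|q|)) / 2) => //.
rewrite rmorphD /= ratr_int fmorph_div /= rmorphD /= rmorph1.
by rewrite fmorph_div /= rmorphD /= !ratr_nat ratr_norm qE.
Qed.

Lemma irrational_iter x n : irrational x -> irrational (iter n gauss_map x).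
Proof. by move=> irr; elim: n => //= n; exact: irrational_gauss_map. Qed.

(** Euclid's algorithm: if x has denominator d and fractional part r / d with
    0 < r < d, then the image of x has denominator r or d - r, whichever is the
    smaller. *)
Lemma rational_gauss_map_int x : rational x ->
  exists n, iter n gauss_map x = (Num.floor (iter n gauss_map x))%:~R.
Proof.
move=> /rationalP[p [d xE]].
elim/ltn_ind: d p x xE => d IH p x xE.
have [/eqP xf|xf] := boolP (x == (Num.floor x)%:~R); first by exists 0%N.
have d0 : (d%:R : R) != 0.
  by apply: contra_neq xf => d0; rewrite xE d0 invr0 mulr0 floor0.
have dgt0 : 0 < d%:R :> R by rewrite lt0r d0 ler0n.
have /andP[t0 t1] := frac_itv xf.
set m := Num.floor x in xf t0 t1.
have [r rE] : exists r : int, r = p - m * d%:Z by exists (p - m * d%:Z).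
have tE : x - m%:~R = r%:~R / d%:R.
  by rewrite rE intrB intrM -pmulrn {1}xE; field.
have r0 : 0 < r%:~R :> R by move: t0; rewrite tE pmulr_lgt0 ?invr_gt0.
have rd : r%:~R < d%:R :> R by move: t1; rewrite tE ltr_pdivrMr// mul1r.
have r0' : 0 < r by rewrite -(ltr0z R).
have rd' : r < d%:Z by rewrite -(ltr_int R).
have step (e : int) : 0 < e -> e < d%:Z ->
    gauss_map x = (2 * r - d%:Z)%:~R / e%:~R ->
    exists n, iter n gauss_map x = (Num.floor (iter n gauss_map x))%:~R.
  case: e => // e e0 ed xe.
  by have [|n nE] := IH e _ _ _ xe; [|exists n.+1; rewrite iterSr].
have [th|/ltW th] := leP (x - m%:~R) (1 / 2).
  apply: (step r) => //; rewrite /gauss_map -/m of01_leE// tE.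
  rewrite intrB intrM mulrz_nat -pmulrn.
  by field; rewrite d0 gt_eqF.
apply: (step (d%:Z - r)); [lia|lia|].
rewrite /gauss_map -/m of01_geE// tE !intrB intrM mulrz_nat -!pmulrn.
by field; rewrite d0 subr_eq0 gt_eqF.
Qed.

Lemma digits_gauss_map x n : digits x n.+1 = digits (gauss_map x) n.
Proof. by rewrite /digits iterSr. Qed.

Lemma digits_close x y n : irrational x -> irrational y ->
  agree n.+1 (digits x) (digits y) -> `|x - y| <= 2^-1 ^+ n.
Proof.
elim: n x y => [|n IH] x y ix iy xy.
  have := xy 0%N isT; rewrite /digits/= => fxy.
  have /andP[x1 x2] := frac_itv (irrational_nint ix).
  have /andP[y1 y2] := frac_itv (irrational_nint iy).
  by rewrite fxy in x1 x2; rewrite expr0 ler_norml; apply/andP; split; lra.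
rewrite [x]floor_gauss_mapE; last exact: irrational_nint.
rewrite [y]floor_gauss_mapE; last exact: irrational_nint.
have := xy 0%N isT; rewrite /digits/= => ->.
rewrite opprD addrACA subrr add0r (le_trans (to01_lipschitz _ _))//.
rewrite exprSr ler_pM2r ?invr_gt0//.
apply: IH; [exact: irrational_gauss_map..|].
by move=> k kn; rewrite -!digits_gauss_map; exact: xy.
Qed.

(** The floor is locally constant at an irrational, and the iterates of an
    irrational are irrational. *)
Lemma digits_near x n : irrational x ->
  \forall y \near x, agree n (digits y) (digits x).
Proof.
elim: n x => [|n IH] x ix; first by near=> y.
have t01 := frac_itv (irrational_nint ix).
have floor_near : \forall y \near x, Num.floor y = Num.floor x.
  have : \forall y \near x, y \in `](Num.floor x)%:~R, (Num.floor x + 1)%:~R[.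
    apply: near_in_itvoo; rewrite in_itv/= intrD/=.
    by case/andP: t01 => ? ?; apply/andP; split; lra.
  apply: filterS => y; rewrite in_itv/= => /andP[/ltW h1 h2].
  by apply: floor_def; rewrite h1.
have cS : of01 (y - (Num.floor x)%:~R) @[y --> x] --> gauss_map x.
  apply: (@continuous_comp _ _ _ (fun y => y - (Num.floor x)%:~R) of01).
    by apply: cvgB; [exact: cvg_id|exact: cvg_cst].
  exact: of01_continuous.
have := cS _ (IH _ (irrational_gauss_map ix)); rewrite /= nbhs_simpl/=.
apply: filterS2 floor_near => y fyx agr [|k]; first by [].
rewrite ltnS => kn; rewrite !digits_gauss_map [gauss_map y]/gauss_map fyx.
exact: agr.
Unshelve. all: end_near.
Qed.

(** [s m + to01 (s (m + 1) + to01 (... + to01 (s (m + n))))] *)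
Fixpoint digits_approx (s : nat -> int) n m : R :=
  if n is n'.+1 then (s m)%:~R + to01 (digits_approx s n' m.+1)
  else (s m)%:~R.

(** For each [m] the approximations increase with [n] and are bounded, because
    [to01] is increasing with values in ]0, 1[. Their limits satisfy
    [L m = s m + to01 (L m.+1)], so [L m] is the [m]-th iterate of [L 0] and is
    never an integer. *)
Lemma digits_surj (s : nat -> int) :
  exists x, irrational x /\ digits x = s.
Proof.
have appr_le n m : digits_approx s n m <= digits_approx s n.+1 m.
  elim: n m => [|n IH] m /=.
    by have /andP[h _] := to01_itv (s m.+1)%:~R; rewrite lerDl ltW.
  rewrite lerD2l -subr_ge0.
  by have /andP[] := to01_contraction (IH m.+1).
have appr_ub n m : digits_approx s n m <= (s m)%:~R + 1.
  case: n => [|n] /=; first by rewrite lerDl.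
  by have /andP[_ h] := to01_itv (digits_approx s n m.+1); rewrite lerD2l ltW.
pose L m := limn (digits_approx s ^~ m).
have apprL m : digits_approx s n m @[n --> \oo] --> L m.
  apply: nondecreasing_is_cvgn; first exact/nondecreasing_seqP.
  by exists ((s m)%:~R + 1) => _ [n _ <-].
have LE m : L m = (s m)%:~R + to01 (L m.+1).
  have apprLS : digits_approx s n.+1 m @[n --> \oo] --> L m.
    by have := apprL m; rewrite -cvg_shiftS.
  apply: (cvg_unique _ apprLS); first exact: Rhausdorff.
  apply: cvgD; first exact: cvg_cst.
  by apply: continuous_cvg; [exact: to01_continuous|exact: apprL].
have iterL n : iter n gauss_map (L 0%N) = L n.
  by elim: n => //= n ->; rewrite LE gauss_map_add_to01.
exists (L 0%N); split.
  move=> /rational_gauss_map_int[n /eqP]; rewrite iterL LE.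
  by rewrite (negbTE (add_to01_nint _ _)).
by apply/funext => n; rewrite /digits iterL LE floor_add_to01.
Qed.

Lemma infinite_int : infinite_set [set: int].
Proof.
move=> fin; apply: infinite_nat.
have -> : [set: nat] = Posz @^-1` [set: int] by rewrite preimage_setT.
by apply: finite_preimage fin => m n _ _ [].
Qed.

Lemma digits_scheme :
  baire_scheme (fun x : set_type (@irrational R) => digits (set_val x)).
Proof.
have irr (x : set_type (@irrational R)) : irrational (set_val x).
  exact: set_mem (valP x).
have surj s : exists x : set_type (@irrational R), digits (set_val x) = s.
  have [x [ix <-]] := digits_surj s.
  by exists (exist _ x (mem_set ix)).
split.
- move=> x y xy; apply: val_inj; apply/eqP; rewrite -subr_eq0 -normr_le0.
  apply/ler_addgt0Pl => e e0; rewrite addr0.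
  have [n _ /(_ n (leqnn n)) ne] := near_infty_natSinv_expn_lt (PosNum e0).
  apply: le_trans (ltW ne); rewrite div1r -exprVn.
  have xyE : digits (set_val x) = digits (set_val y) by [].
  by apply: digits_close; [exact: irr..|rewrite xyE].
- by move=> s _; exact: surj.
- move=> x W; split=> [|[n nW]].
    rewrite nbhsE => -[_ [[V oV <-] Vx] VW].
    have : nbhs (set_val x : R) V by exact: open_nbhs_nbhs.
    move=> /nbhs_ballP[e /= e0 eV].
    have [n _ /(_ n (leqnn n)) ne] := near_infty_natSinv_expn_lt (PosNum e0).
    exists n.+1 => y xy; apply/VW/eV; rewrite -ball_normE/= distrC.
    apply: le_lt_trans ne; rewrite div1r -exprVn.
    by apply: digits_close; [exact: irr..|exact: xy].
  apply: filterS nW _.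
  exact: (@initial_continuous _ _ set_val x _ (digits_near n (irr x))).
- move=> x n.
  pose c (y : set_type (@irrational R)) := digits (set_val y).
  have -> : c^~ n @` cylinder c n x = [set: int].
    apply/seteqP; split=> // a _.
    have [y yE] := surj (fun k => if (k < n)%N then c x k else a).
    exists y; last by rewrite /c yE ltnn.
    by move=> k kn; rewrite {1}/c yE kn.
  rewrite card_eqPle; split; first exact: countableP.
  exact/infiniteP/infinite_int.
Qed.
End Irrational.

(** * The characterization *)

Theorem theorem2p2 (R : realType) (F : pfilter_on nat) :
  frechet_urysohn_filter F ->
  (homeomorphic (set_type (Sc (xi F))) (set_type (@irrational R)) <->
   has_countable_base F).
Proof.
move=> [free _].
have [x [ix _]] := @digits_surj R (fun=> 0%R).
pose x0 : set_type (@irrational R) := exist _ x (mem_set ix).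
split=> [[f [g [cf cg fK gK]]]|].
  have [_ _ Rnbhs _] := digits_scheme R.
  pose W n := f @^-1`
    cylinder (fun y : set_type (@irrational R) => digits (set_val y)) n x0.
  apply: (@countable_base_of_local_base F free (g x0) W).
    move=> n; apply: cf; rewrite gK.
    by apply/Rnbhs; exists n.
  move=> V Vx; have /Rnbhs[n nV] : nbhs x0 (g @^-1` V) by exact: cg.
  by exists n => S /nV; rewrite /= fK.
move=> /decreasing_base[U [U0 U_decr FU U_base]].
have Sc_scheme := label_scheme free U0 U_decr FU U_base.
apply: baire_scheme_homeomorphic Sc_scheme (digits_scheme R).
  exact: Sc_nonempty U_decr FU U_base.
by exists x0.
Qed.
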